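(* Let $M$ be a positive integer. Suppose $x>2$, $y>0$, and $c$ are integers such that $3^y\equiv c+2^x \bmod M$. If $O_3'(M)$ is not divisible by $2^{x-1}$ and $O_2'(M)$ is not divisible by $3^{y}$, then there are integers $x'\ge 0$ and $y'\ge 0$ such that (a) $3^{y'}\equiv c+2^{x'}\bmod M$, (b) $2^{x'}$ is an indeterminate power of $2$ modulo $M$, and (c) $3^{y'}$ is an indeterminate power of $3$ modulo $M$.
   Context: For a positive integer $M$, write $M=2^u3^vM'$ with $u,v\ge 0$ integers and $M'$ a positive integer coprime to $6$. Then $O_2'(M)$ denotes the multiplicative order of $2$ in the ring $\mathbf{Z}/M'\mathbf{Z}$, and $O_3'(M)$ denotes the multiplicative order of $3$ in the ring $\mathbf{Z}/M'\mathbf{Z}$ (both are $1$ if $M'=1$). For an integer $M>0$, a prime $p$ and an integer $i\ge 0$, the power $p^i$ is called determinate modulo $M$ if the only integer $b\ge 0$ with $p^b\equiv p^i\bmod M$ is $b=i$; otherwise $p^i$ is called an indeterminate power of $p$ modulo $M$. *)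

(* Defs.v *)
From mathcomp Require Import all_boot all_order all_algebra all_fingroup.
From mathcomp Require Import all_solvable.

Set Implicit Arguments.
Unset Strict Implicit.
Unset Printing Implicit Defensive.

Import GRing.Theory.

(* The M' of M = 2 ^ u * 3 ^ v * M' with M' coprime to 6. *)
Definition part6' (M : nat) : nat := M`_(\pi(6)^').

Lemma part6'E (M u v M' : nat) :
  0 < M' -> coprime M' 6 -> M = 2 ^ u * 3 ^ v * M' -> part6' M = M'.
Proof.
move=> M'_gt0 coM'6 ->; rewrite /part6' partnM ?muln_gt0 ?expn_gt0 //.
rewrite part_p'nat ?mul1n; last first.
  by rewrite pnatNK pnatM !pnatX orbC /= orbC /=.
by rewrite part_pnat_id // -coprime_pi' // coprime_sym.
Qed.

(* For m > 1 the default value 1 of insubd is used only when a is not a unit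
   modulo m.  As 'Z_1 is Z/2Z, the zero ring m = 1 is treated separately. *)
Definition mult_order (a m : nat) : nat :=
  if m == 1 then 1
  else #[insubd (1%g : {unit 'Z_m}) (a%:R%R : 'Z_m)]%g.

Lemma mult_order_dvdn (a m k : nat) : 0 < m -> coprime a m ->
  (mult_order a m %| k) = (a ^ k == 1 %[mod m]).
Proof.
case: m => [//|[|m]] _ co_am; first by rewrite /mult_order /= dvd1n !modn1.
rewrite /mult_order /= order_dvdn -val_eqE FinRing.val_unitX /=.
rewrite /insubd insubT /= => [|unit_a].
  by rewrite unitZpE // coprime_sym.
by rewrite -natrX -val_eqE /= !val_Zp_nat.
Qed.

Definition O2' (M : nat) : nat := mult_order 2 (part6' M).
Definition O3' (M : nat) : nat := mult_order 3 (part6' M).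

Definition determinate (M p i : nat) : Prop :=
  forall b : nat, p ^ b = p ^ i %[mod M] -> b = i.

Definition indeterminate (M p i : nat) : Prop := ~ determinate M p i.

(* Main.v *)
(* Adjust the exponents separately at 2, at 3 and at N = part6' M.  As x > 2,
   3 ^ y - 2 ^ x agrees 2-adically with 3 ^ y to precision x, and the powers
   of 3 ^ L approximate 1 + 2 ^ x Z_2 as soon as 3 ^ L - 1 has 2-adic valuation
   exactly x, i.e. L has valuation x - 2.  The hypothesis on the order of 3
   modulo N provides such an L that is also a multiple of that order, so some
   power of 3 is 3 ^ y - 2 ^ x modulo 2 ^ u and 3 ^ y modulo N.  Symmetrically,
   some power of 2 is 2 ^ x - 3 ^ y modulo 3 ^ v and 2 ^ x modulo N.  Enlarging
   both exponents by periods makes 2 ^ x' vanish modulo 2 ^ u and 3 ^ y' vanish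
   modulo 3 ^ v, which gives both the congruence and indeterminacy. *)
Require Import Defs.
From mathcomp Require Import all_boot all_order all_algebra.
From mathcomp Require Import all_solvable ring zify.

Set Implicit Arguments.
Unset Strict Implicit.
Unset Printing Implicit Defensive.

Import GRing.Theory.
Local Open Scope ring_scope.

(** * Geometric sums and the exact valuation of [a ^ n - 1] *)

Lemma dvdz_expB1 (a k m : nat) :
  (m%:Z %| a%:Z ^+ k - 1)%Z = (a ^ k == 1 %[mod m])%N.
Proof. by rewrite -eqz_mod_dvd -rmorphXn -[1]/(1%:Z) !modz_nat eqz_nat. Qed.

Lemma dvdz_expB1_mul (d a : int) (m n : nat) :
  (d %| a ^+ m - 1)%Z -> (d %| a ^+ (m * n) - 1)%Z.
Proof. by move=> dv; rewrite exprM subrX1 dvdz_mulr. Qed.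

Lemma dvdz_geom_sum (p a : int) (n : nat) :
  (p %| a - 1)%Z -> (p %| \sum_(i < n) a ^+ i - n%:Z)%Z.
Proof.
move=> dv; elim: n => [|n IHn]; first by rewrite big_ord0 subrr dvdz0.
have -> : \sum_(i < n.+1) a ^+ i - n.+1%:Z =
          (\sum_(i < n) a ^+ i - n%:Z) + (a ^+ n - 1).
  by rewrite big_ord_recr /= -addn1 PoszD; ring.
by rewrite rpredD // subrX1 dvdz_mulr.
Qed.

(** Modulo [p ^ 2] the powers of [1 + p * b] are linear in the exponent, and summing the exponents
    gives ['C(n, 2)]. The case [n = p] controls the quotient of [a ^ p - 1] by [a - 1]. *)
Lemma dvdz_geom_sum_sqr (p b : int) (n : nat) :
  (p ^+ 2 %| \sum_(i < n) (1 + p * b) ^+ i - (n%:Z + p * b * 'C(n, 2)%:Z))%Z.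
Proof.
have step k : (p ^+ 2 %| (1 + p * b) ^+ k - (1 + p * b * k%:Z))%Z.
  elim: k => [|k IHk]; first by rewrite mulr0 addr0 subrr dvdz0.
  have -> : (1 + p * b) ^+ k.+1 - (1 + p * b * k.+1%:Z) =
    (1 + p * b) * ((1 + p * b) ^+ k - (1 + p * b * k%:Z))
      + p ^+ 2 * (b ^+ 2 * k%:Z).
    by rewrite exprS -addn1 PoszD; ring.
  by apply: rpredD; [exact: dvdz_mull | exact: dvdz_mulr].
elim: n => [|n IHn]; first by rewrite big_ord0 bin0n mulr0 dvdz0.
have -> : \sum_(i < n.+1) (1 + p * b) ^+ i
            - (n.+1%:Z + p * b * 'C(n.+1, 2)%:Z) =
    (\sum_(i < n) (1 + p * b) ^+ i - (n%:Z + p * b * 'C(n, 2)%:Z))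
    + ((1 + p * b) ^+ n - (1 + p * b * n%:Z)).
  by rewrite big_ord_recr /= binS bin1 -addn1 !PoszD; ring.
by rewrite rpredD.
Qed.

(** For [p] prime: the [p]-adic valuation of [a - 1] is exactly [k], which excludes [a = 1]. *)
Definition exact_level (p k : nat) (a : int) : Prop :=
  exists2 w : int, a - 1 = p%:Z ^+ k * w & ~~ (p%:Z %| w)%Z.

Lemma Euclid_dvdzM (p : nat) (a b : int) : prime p ->
  (p%:Z %| a * b)%Z = (p%:Z %| a)%Z || (p%:Z %| b)%Z.
Proof. by move=> p_pr; rewrite !dvdzE abszM Euclid_dvdM. Qed.

(** The quotient of [a ^ n - 1] by [a - 1] is a geometric sum, congruent to [n] and hence nonzero
    modulo [p]. *)
Lemma exact_level_exp_coprime (p k n : nat) (a : int) :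
  prime p -> (0 < k)%N -> ~~ (p %| n)%N ->
  exact_level p k a -> exact_level p k (a ^+ n).
Proof.
move=> p_pr k_gt0 pNn [w Ea pNw].
exists (w * \sum_(i < n) a ^+ i); first by rewrite subrX1 Ea mulrA.
rewrite Euclid_dvdzM // (negPf pNw) /=.
have dv : (p%:Z %| a - 1)%Z by rewrite Ea dvdz_mulr // dvdz_exp.
by rewrite -(rpredBr _ (dvdz_geom_sum n dv)) subKr.
Qed.

(* For [p = 2] the hypothesis [1 < k] cannot be dropped: 3 - 1 = 2 but
   3 ^ 2 - 1 = 8. *)
Lemma exact_level_exp_prime (p k : nat) (a : int) :
  prime p -> (0 < k)%N -> (p = 2%N -> 1 < k)%N ->
  exact_level p k a -> exact_level p k.+1 (a ^+ p).
Proof.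
move=> p_pr; case: k => // k _ k_gt1 [w Ea pNw].
set b := p%:Z ^+ k * w.
have {Ea} Ea : a = 1 + p%:Z * b by rewrite /b mulrA -exprS -Ea; ring.
(* This kills the second-order term modulo [p ^ 2]. The factor [p] comes from [b] if [p = 2], and
   from the binomial coefficient if [p] is odd. *)
have pB : (p%:Z %| b * 'C(p, 2)%:Z)%Z.
  case: (eqVneq p 2%N) => [p2|pN2].
    have k_gt0 := k_gt1 p2; rewrite /b -mulrA.
    by rewrite dvdz_mulr // dvdz_exp.
  rewrite dvdz_mull // dvdzE /= prime_dvd_bin //=.
  by rewrite ltn_neqAle eq_sym pN2 prime_gt1.
have [q Eq] := dvdzP (dvdz_geom_sum_sqr p%:Z b p).
have [r Er] := dvdzP pB.
exists (w * (1 + p%:Z * (q + r))).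
  have -> : p%:Z ^+ k.+2 * (w * (1 + p%:Z * (q + r))) =
    p%:Z * b * (q * p%:Z ^+ 2 + (p%:Z + p%:Z * (r * p%:Z))).
    by rewrite /b !exprS; ring.
  by rewrite -Eq -Er Ea subrX1; ring.
rewrite Euclid_dvdzM // (negPf pNw) /= rpredDr ?dvdz_mulr //.
by rewrite dvdzE /= dvdn1 neq_ltn prime_gt1 ?orbT.
Qed.

Lemma exact_level_iter (p k n : nat) (a : int) :
  prime p -> (0 < k)%N -> (p = 2%N -> 1 < k)%N ->
  exact_level p k a -> exact_level p (k + n) (a ^+ (p ^ n)).
Proof.
move=> p_pr k_gt0 k_gt1 lev_a; elim: n => [|n IHn]; first by rewrite addn0.
rewrite expnSr exprM addnS; apply: exact_level_exp_prime => //.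
  by rewrite addn_gt0 k_gt0.
by move=> /k_gt1; lia.
Qed.

(** One [p]-adic digit is corrected at each induction step: [g ^ (L * p ^ n)] is [1] to precision
    exactly [k + n], so multiplying by its powers reaches every value of the next digit and keeps
    the earlier ones. *)
Lemma exp_approx (p k L y n : nat) (g t : int) :
  prime p -> (0 < k)%N -> (p = 2%N -> 1 < k)%N -> ~~ (p%:Z %| g)%Z ->
  exact_level p k (g ^+ L) -> (p%:Z ^+ k %| t - g ^+ y)%Z ->
  exists i : nat, (p%:Z ^+ (k + n) %| t - g ^+ (y + L * i))%Z.
Proof.
move=> p_pr k_gt0 k_gt1 pNg lev_g dv_t.
elim: n => [|n [i /dvdzP[s Es]]]; first by exists 0%N; rewrite addn0 muln0 addn0.
have := exact_level_iter n p_pr k_gt0 k_gt1 lev_g.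
set N := (k + n)%N in Es *; set A := _ ^+ (p ^ n) => -[w EA pNw].
set G := g ^+ _ in Es.
have co_p : coprimez p (G * w).
  rewrite coprimezE prime_coprime // -[(p %| _)%N]/((p%:Z %| _)%Z).
  rewrite Euclid_dvdzM // negb_or pNw andbT.
  apply/negP => dvG; move/negP: pNg; apply; move: dvG.
  by rewrite /G !dvdzE abszX Euclid_dvdX // => /andP[].
have [[u v] /= Euv] := coprimezP _ _ co_p.
(* Since [v] inverts [G * w] modulo [p], this [j] makes [G * w * j] cancel the error digit [s]; the
   residue is nonnegative, so it can serve as an exponent. *)
set j := `|(v * s %% p)%Z|%N.
have p0 : p%:Z != 0 by rewrite eqz_nat -lt0n prime_gt0.
have Ej : j%:Z = v * s - (v * s %/ p)%Z * p%:Z.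
  by rewrite gez0_abs ?modz_ge0 // {2}(divz_eq (v * s) p); ring.
exists (i + p ^ n * j)%N.
have dvA : (p%:Z %| A - 1)%Z by rewrite EA dvdz_mulr // dvdz_exp // addn_gt0 k_gt0.
have [e Ee] := dvdzP (dvdz_geom_sum j dvA).
have EAj : A ^+ j - 1 = p%:Z ^+ N * w * (j%:Z + e * p%:Z).
  by rewrite subrX1 EA -Ee; ring.
have -> : t - g ^+ (y + L * (i + p ^ n * j)) =
    (t - G) - G * (A ^+ j - 1).
  by rewrite mulnDr addnA exprD !exprM -/G -/A; ring.
have Es' : s = s * (u * p%:Z + v * (G * w)) by rewrite Euv mulr1.
rewrite EAj Es addnS exprS {1}Es' Ej; apply/dvdzP.
exists (s * u - G * w * (e - (v * s %/ p)%Z)); ring.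
Qed.

(** * Multiplicative orders, periods and the adjustment of exponents *)

Lemma mult_order_gt0 (a m : nat) : (0 < mult_order a m)%N.
Proof. by rewrite /mult_order; case: eqP. Qed.

(** The [q]-part of [n] is at most [q ^ k]. Applied to an order, this yields a multiple of it with
    [q]-valuation exactly [k]. *)
Lemma dvdn_expn_partC (q k n : nat) : prime q -> (0 < n)%N ->
  ~~ (q ^ k.+1 %| n)%N -> (n %| q ^ k * n`_q^')%N.
Proof.
move=> q_pr n_gt0; rewrite pfactor_dvdn // -leqNgt => le_k.
by rewrite -{1}(partnC q n_gt0) p_part dvdn_mul // dvdn_exp2l.
Qed.

Lemma prime_ndvd_partC (q n : nat) : prime q -> ~~ (q %| n`_q^')%N.
Proof.
by move=> q_pr; rewrite -prime_coprime // (@pnat_coprime q) ?pnat_id ?part_pnat.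
Qed.

Lemma dvdz_expB1_mult_order (a m n : nat) :
  (0 < m)%N -> coprime a m -> (mult_order a m %| n)%N ->
  (m%:Z %| a%:Z ^+ n - 1)%Z.
Proof. by move=> m_gt0 co; rewrite dvdz_expB1 mult_order_dvdn. Qed.

Lemma dvdz_expB1_totient (a m n : nat) :
  coprime a m -> (m%:Z %| a%:Z ^+ (totient m * n) - 1)%Z.
Proof.
move=> co; apply: dvdz_expB1_mul.
by rewrite dvdz_expB1 (Euler_exp_totient co).
Qed.

(** Once [p ^ u] is factored out of [p ^ i], adding [totient N] to the exponent changes nothing
    modulo [N]. *)
Lemma indeterminate_ge (p u N i : nat) : (0 < N)%N -> coprime p N ->
  (u <= i)%N -> indeterminate (p ^ u * N) p i.
Proof.
move=> N_gt0 co le_ui det.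
suff /det/eqP : (p ^ (i + totient N) = p ^ i %[mod p ^ u * N])%N.
  by rewrite -{2}[i]addn0 eqn_add2l eqn0Ngt totient_gt0 N_gt0.
rewrite -(subnKC le_ui) -addnA !expnD -!muln_modr; congr (_ * _)%N.
by rewrite -modnMmr (Euler_exp_totient co) modnMmr muln1.
Qed.

Lemma factor_2_3 (M : nat) : (0 < M)%N ->
  exists u v N : nat, [/\ (0 < N)%N, coprime N 6 & M = (2 ^ u * 3 ^ v * N)%N].
Proof.
move=> M_gt0; have [R coR EM] := pfactor_coprime (isT : prime 2) M_gt0.
have R_gt0 : (0 < R)%N by move: M_gt0; rewrite EM muln_gt0; case/andP.
have [N coN ER] := pfactor_coprime (isT : prime 3) R_gt0.
exists (logn 2 M), (logn 3 R), N; split; last by rewrite {1}EM {1}ER; ring.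
  by move: R_gt0; rewrite ER muln_gt0; case/andP.
rewrite (coprimeMr N 2 3) ![coprime N _]coprime_sym coN andbT.
by apply: coprime_dvdr coR; rewrite ER dvdn_mulr.
Qed.

(** Adding multiples of [L] to [y] approximates [t] at [p] and is invisible modulo [m]; adding
    [K * v], a multiple of a common period, then makes the exponent at least [v]. *)
Lemma exponent_adjust (p g k L y u v m : nat) (t : int) :
  prime p -> (0 < k)%N -> (p = 2%N -> 1 < k)%N -> (0 < m)%N ->
  coprime g p -> coprime g m -> exact_level p k (g%:Z ^+ L) ->
  (m%:Z %| g%:Z ^+ L - 1)%Z -> (p%:Z ^+ k %| t - g%:Z ^+ y)%Z ->
  exists z : nat,
    [/\ (v <= z)%N, (p%:Z ^+ u %| t - g%:Z ^+ z)%Z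
      & (m%:Z %| g%:Z ^+ y - g%:Z ^+ z)%Z].
Proof.
move=> p_pr k_gt0 k_gt1 m_gt0 co_gp co_gm lev_g dv_m dv_t.
have pNg : ~~ (p%:Z %| g%:Z)%Z by rewrite dvdzE /= -prime_coprime // coprime_sym.
have [i dv_i] := exp_approx u p_pr k_gt0 k_gt1 pNg lev_g dv_t.
have co_g : coprime g (p ^ u * m) by rewrite coprimeMr coprimeXr.
pose K := totient (p ^ u * m).
have K_gt0 : (0 < K)%N by rewrite totient_gt0 muln_gt0 expn_gt0 prime_gt0.
have dvK : ((p ^ u * m)%N%:Z %| g%:Z ^+ (K * v) - 1)%Z.
  exact: dvdz_expB1_totient.
exists (y + L * i + K * v)%N; split.
- by rewrite -[leqLHS]add0n leq_add // leq_pmull.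
- have -> : t - g%:Z ^+ (y + L * i + K * v) =
      (t - g%:Z ^+ (y + L * i))
      - g%:Z ^+ (y + L * i) * (g%:Z ^+ (K * v) - 1).
    by rewrite exprD; ring.
  rewrite rpredB ?dvdz_mull //.
    by apply: dvdz_trans dv_i; rewrite dvdz_exp2l ?leq_addl.
  by apply: dvdz_trans dvK; rewrite PoszM -rmorphXn dvdz_mulr.
- have -> : g%:Z ^+ y - g%:Z ^+ (y + L * i + K * v) =
      - (g%:Z ^+ y * (g%:Z ^+ (L * i) - 1)
         + g%:Z ^+ (y + L * i) * (g%:Z ^+ (K * v) - 1)).
    by rewrite !exprD; ring.
  rewrite rpredN; apply: rpredD; apply: dvdz_mull; first exact: dvdz_expB1_mul.
  by apply: dvdz_trans dvK; rewrite PoszM dvdz_mull.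
Qed.

(** Lifting starts from [3 ^ 2 = 1 + 2 ^ 3], as [3 - 1] has 2-adic valuation only 1, too low to
    lift. *)
Lemma exact_level_3 (n t : nat) : ~~ (2 %| t)%N ->
  exact_level 2 (3 + n) (3%:Z ^+ (2 * (2 ^ n * t))).
Proof.
move=> t_odd; rewrite exprM exprM.
apply: exact_level_exp_coprime => //; apply: exact_level_iter => //.
by exists 1.
Qed.

(** Lifting starts from [2 ^ 2 = 1 + 3], as [2] itself is not [1] modulo [3]. *)
Lemma exact_level_2 (n t : nat) : ~~ (3 %| t)%N ->
  exact_level 3 (1 + n) (2%:Z ^+ (2 * (3 ^ n * t))).
Proof.
move=> tN3; rewrite exprM exprM.
apply: exact_level_exp_coprime => //; apply: exact_level_iter => //.
by exists 1.
Qed.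

Local Close Scope ring_scope.

Theorem lemma3p1 (M : nat) (x y : nat) (c : int) :
  0 < M -> 2 < x -> 0 < y ->
  (3 ^+ y = c + 2 ^+ x %[mod M])%Z ->
  ~~ (2 ^ (x - 1) %| O3' M) ->
  ~~ (3 ^ y %| O2' M) ->
  exists x' y' : nat,
    [/\ (3 ^+ y' = c + 2 ^+ x' %[mod M])%Z,
        indeterminate M 2 x'
      & indeterminate M 3 y'].
Proof.
move=> M_gt0 x_gt2 y_gt0 /eqP; rewrite eqz_mod_dvd => dvM.
have [u [v [N [N_gt0 coN EM]]]] := factor_2_3 M_gt0.
rewrite /O3' /O2' (part6'E N_gt0 coN EM).
have /andP[co2N co3N] : coprime 2 N && coprime 3 N.
  by rewrite -coprimeMl coprime_sym.
set O3 := mult_order 3 N; set O2 := mult_order 2 N => ndvO3 ndvO2.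
have [n Ex] : exists n, x = 3 + n by exists (x - 3); rewrite subnKC.
have [l Ey] : exists l, y = 1 + l by exists (y - 1); rewrite subnKC.
(* Here [2 * 2 ^ n] is [2 ^ (x - 2)], the largest power of 2 that the hypothesis allows in [O3]. *)
have dvO3 : O3 %| 2 * (2 ^ n * O3`_2^').
  rewrite mulnA -expnS; apply: dvdn_expn_partC => //.
    exact: mult_order_gt0.
  by move: ndvO3; rewrite Ex.
(* Here [3 ^ l] is [3 ^ (y - 1)]; the extra factor [2] does not affect the 3-adic valuation and
   provides the base [2 ^ 2]. *)
have dvO2 : O2 %| 2 * (3 ^ l * O2`_3^').
  apply: dvdn_mull; apply: dvdn_expn_partC => //.
    exact: mult_order_gt0.
  by move: ndvO2; rewrite Ey.
have lev3 := exact_level_3 n (prime_ndvd_partC O3 (isT : prime 2)).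
have lev2 := exact_level_2 l (prime_ndvd_partC O2 (isT : prime 3)).
rewrite -Ex in lev3; rewrite -Ey in lev2.
have dvN3 := dvdz_expB1_mult_order N_gt0 co3N dvO3.
have dvN2 := dvdz_expB1_mult_order N_gt0 co2N dvO2.
have dvt3 : (2%:Z ^+ x %| (3%:Z ^+ y - 2%:Z ^+ x) - 3%:Z ^+ y)%Z%R.
  by rewrite addrAC subrr sub0r rpredN.
have dvt2 : (3%:Z ^+ y %| (2%:Z ^+ x - 3%:Z ^+ y) - 2%:Z ^+ x)%Z%R.
  by rewrite addrAC subrr sub0r rpredN.
have x_gt1 : 2 = 2 -> 1 < x by rewrite ltnW.
have y_gt1 : 3 = 2 -> 1 < y by [].
have [y' [le_vy' dvu dvNy]] := exponent_adjust u v (isT : prime 2)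
  (ltnW (ltnW x_gt2)) x_gt1 N_gt0 (isT : coprime 3 2) co3N lev3 dvN3 dvt3.
have [x' [le_ux' dvv dvNx]] := exponent_adjust v u (isT : prime 3)
  y_gt0 y_gt1 N_gt0 (isT : coprime 2 3) co2N lev2 dvN2 dvt2.
exists x', y'; split.
- have split_dv z : (M %| z)%Z =
      [&& 2%:Z ^+ u %| z, 3%:Z ^+ v %| z & N %| z]%Z%R.
    rewrite EM !PoszM -!(rmorphXn Posz) !Gauss_dvdz -?andbA //.
      by rewrite coprimezE /= coprimeXl ?coprimeXr.
    by rewrite coprimezMl !coprimezE /= !coprimeXl.
  move: dvM; rewrite split_dv => /and3P[dvM2 dvM3 dvMN].
  apply/eqP; rewrite eqz_mod_dvd split_dv; apply/and3P.
  (* [D] and [E] agree modulo each factor: modulo [2 ^ u], [3 ^ y'] is [3 ^ y - 2 ^ x] and [2 ^ x']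
     vanishes; modulo [3 ^ v] the roles are exchanged; modulo [N] neither power has changed. *)
  set E := (3 ^+ y - _)%R in dvM2 dvM3 dvMN; set D := (3 ^+ y' - _)%R.
  split.
  + have -> : D = (E - (3%:Z ^+ y - 2%:Z ^+ x - 3%:Z ^+ y') - 2%:Z ^+ x')%R.
      by rewrite /D /E; ring.
    by apply: rpredB; [exact: rpredB | exact: dvdz_exp2l].
  + have -> : D = (E + (2%:Z ^+ x - 3%:Z ^+ y - 2%:Z ^+ x') + 3%:Z ^+ y')%R.
      by rewrite /D /E; ring.
    by apply: rpredD; [exact: rpredD | exact: dvdz_exp2l].
  + have -> : D = (E - (3%:Z ^+ y - 3%:Z ^+ y') + (2%:Z ^+ x - 2%:Z ^+ x'))%R.
      by rewrite /D /E; ring.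
    by rewrite rpredD // rpredB.
- rewrite EM -mulnA; apply: indeterminate_ge => //.
    by rewrite muln_gt0 expn_gt0.
  by rewrite coprimeMr coprimeXr.
- rewrite EM (mulnC (2 ^ u)) -mulnA; apply: indeterminate_ge => //.
    by rewrite muln_gt0 expn_gt0.
  by rewrite coprimeMr coprimeXr.
Qed.
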